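(* There exist a network $N=(V,A,c)$, a subset $X\subseteq V$ and distinct $y,z\in V$ such that $\lambda^N_{yz}(X)>\varphi^N_{yz}(X)$.
   Context: $\mathbb{N}_0$ is the set of non-negative integers; $[m]=\{1,\dots,m\}$ and $[0]=\varnothing$. A network $N=(V,A,c)$ consists of a finite set $V$ with $|V|\ge 2$, the arc set $A=\{(u,v)\in V^2: u\ne v\}$ of the complete digraph on $V$, and a capacity function $c:A\to\mathbb{N}_0$. For $u\in V$, $A_u^+$ is the set of arcs $(u,v)\in A$ and $A_u^-$ is the set of arcs $(v,u)\in A$. Flows. For distinct $y,z\in V$, a flow from $y$ to $z$ in $N$ is a function $f:A\to\mathbb{N}_0$ with $f(a)\le c(a)$ for all $a\in A$ and $\sum_{a\in A_u^-}f(a)=\sum_{a\in A_u^+}f(a)$ for all $u\in V\setminus\{y,z\}$. Its value is $v(f)=\sum_{a\in A_y^+}f(a)-\sum_{a\in A_y^-}f(a)$. $\varphi^N_{yz}$ denotes the maximum of $v(f)$ over all flows $f$ from $y$ to $z$ in $N$. For $X\subseteq V$, $N_X=(V,A,c_X)$ is the network with $c_X(a)=0$ if at least one endpoint of $a$ lies in $X$, and $c_X(a)=c(a)$ otherwise. Define $\varphi^N_{yz}(X)=\varphi^N_{yz}-\varphi^{N_X}_{yz}$. Paths. A path from $y$ to $z$ in $N$ is given by distinct vertices $x_1=y,x_2,\dots,x_k=z$ ($k\ge2$) with arcs $(x_i,x_{i+1})$, $i\in[k-1]$, all of capacity at least $1$; for such a path $\gamma$, $V(\gamma)$ and $A(\gamma)$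 denote its sets of vertices and arcs. It passes through $X\subseteq V$ if $X\cap V(\gamma)\neq\varnothing$. For $m\in\mathbb{N}_0$, a sequence $\boldsymbol{\gamma}=(\gamma_j)_{j\in[m]}$ of $m$ paths (repetitions allowed) from $y$ to $z$ in $N$ is arc-disjoint if $|\{j\in[m]:a\in A(\gamma_j)\}|\le c(a)$ for every $a\in A$; its length is $m$ (the empty sequence, of length $0$, is arc-disjoint). $\mathcal{M}^N_{yz}$ is the set of arc-disjoint sequences of paths from $y$ to $z$ in $N$ of maximum length. $l_X(\boldsymbol{\gamma})$ is the number of indices $j\in[m]$ such that $\gamma_j$ passes through $X$. Define $\lambda^N_{yz}(X)=\min_{\boldsymbol{\gamma}\in\mathcal{M}^N_{yz}}l_X(\boldsymbol{\gamma})$. *)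

(* Defs.v *)
From mathcomp Require Import all_boot all_order all_algebra.
From mathcomp Require Import boolp classical_sets.
Set Implicit Arguments.
Unset Strict Implicit.
Unset Printing Implicit Defensive.
Import Order.TTheory GRing.Theory Num.Theory.
Local Open Scope nat_scope.
Local Open Scope classical_set_scope.

(* The default [x0] is returned only when [S] has no maximum (minimum); the
   lemmas [max_flowP] and [lambdaP] below show that this never happens for the
   sets considered here. *)
Definition maximum (d : Order.disp_t) (T : porderType d) (x0 : T) (S : set T)
  : T := xget x0 (S `&` ubound S).
Definition minimum (d : Order.disp_t) (T : porderType d) (x0 : T) (S : set T)
  : T := xget x0 (S `&` lbound S).

Definition arc (V : finType) : finType := {a : V * V | a.1 != a.2}.
Definition src (V : finType) (a : arc V) : V := (val a).1.
Definition tgt (V : finType) (a : arc V) : V := (val a).2.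

Record network := Network {
  vertex :> finType;
  vertex_ge2 : 2 <= #|vertex|;
  cap : arc vertex -> nat
}.

Definition outflow (V : finType) (f : arc V -> nat) (u : V) : nat :=
  \sum_(a : arc V | src a == u) f a.
Definition inflow (V : finType) (f : arc V -> nat) (u : V) : nat :=
  \sum_(a : arc V | tgt a == u) f a.

Definition is_flow (N : network) (y z : N) (f : arc N -> nat) : Prop :=
  (forall a, f a <= cap a) /\
  (forall u : N, u != y -> u != z -> inflow f u = outflow f u).

Definition flow_value (V : finType) (y : V) (f : arc V -> nat) : int :=
  ((outflow f y)%:Z - (inflow f y)%:Z)%R.

Definition max_flow (N : network) (y z : N) : int :=
  maximum 0%R [set flow_value y f | f in [set f | is_flow y z f]].

Definition remove (N : network) (X : {set N}) : network :=
  @Network N (vertex_ge2 N)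
    (fun a => if (src a \in X) || (tgt a \in X) then 0 else cap a).

Definition phi (N : network) (y z : N) (X : {set N}) : int :=
  (max_flow y z - @max_flow (remove X) y z)%R.

(* A path is represented by its full vertex sequence [:: x_1; ...; x_k]. *)
Definition path_arcs (V : finType) (g : seq V) : {set arc V} :=
  [set a : arc V | val a \in zip g (behead g)]%SET.

(* Consecutive vertices of a duplicate-free sequence are distinct, so each
   pair (x_i, x_{i+1}) is an arc and occurs in [path_arcs g]. *)
Definition is_path (N : network) (y z : N) (g : seq N) : Prop :=
  [/\ 2 <= size g, uniq g, head y g = y, last y g = z
    & forall a, a \in path_arcs g -> 1 <= cap a].

Definition passes_through (V : finType) (X : {set V}) (g : seq V) : bool :=
  has (fun x => x \in X) g.

Definition arc_disjoint (N : network) (y z : N) (gs : seq (seq N)) : Prop :=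
  (forall g, g \in gs -> is_path y z g) /\
  (forall a : arc N, count (fun g => a \in path_arcs g) gs <= cap a).

Definition max_arc_disjoint (N : network) (y z : N) : set (seq (seq N)) :=
  [set gs | arc_disjoint y z gs /\
    forall gs', arc_disjoint y z gs' -> size gs' <= size gs].

Definition num_through (V : finType) (X : {set V}) (gs : seq (seq V)) : nat :=
  count (passes_through X) gs.

Definition lambda (N : network) (y z : N) (X : {set N}) : nat :=
  minimum 0 [set num_through X gs | gs in max_arc_disjoint y z].

Lemma max_flowP (N : network) (y z : N) :
  (exists2 f, is_flow y z f & flow_value y f = max_flow y z) /\
  (forall f, is_flow y z f -> (flow_value y f <= max_flow y z)%R).
Proof.
set S := [set flow_value y f | f in [set f | is_flow y z f]].
pose P n := `[< S (n%:Z)%R >].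
have S0 : S 0%R.
  exists (fun=> 0) => /=; last by rewrite /flow_value /outflow /inflow !big1.
  by split=> // u _ _; rewrite /outflow /inflow !big1.
have bd k : S k -> (k <= (\sum_(a : arc N) cap a)%N%:Z)%R.
  move=> [f [fc _] <-]; apply: (@le_trans _ _ (outflow f y)%:Z%R).
    by rewrite /flow_value gerBl.
  rewrite lez_nat /outflow big_mkcond /=; apply: leq_sum => a _.
  by case: ifP.
have exP : exists n, P n by exists 0; apply/asboolP.
have bP n : P n -> n <= \sum_(a : arc N) cap a by move=> /asboolP /bd; rewrite lez_nat.
have [n /asboolP Pn nmax] := ex_maxnP exP bP.
have : (S `&` ubound S) (max_flow y z).
  apply: xgetPex; exists (n%:Z)%R; split=> // k Sk.
  case: k Sk => [k Sk|k _ //]; rewrite lez_nat; apply: nmax; exact/asboolP.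
case=> [[f ff <-] ub]; split; first by exists f.
by move=> g gf; apply: ub; exists g.
Qed.

Lemma arc_disjoint_size (N : network) (y z : N) (gs : seq (seq N)) :
  arc_disjoint y z gs -> size gs <= \sum_(a : arc N) cap a.
Proof.
case=> pgs cgs.
apply: (@leq_trans (\sum_(a : arc N) count (fun g => a \in path_arcs g) gs));
  last by apply: leq_sum => a _; exact: cgs.
under eq_bigr => a _ do rewrite -sum1_count big_mkcond.
rewrite exchange_big /= -sum1_size big_seq [X in _ <= X]big_seq.
apply: leq_sum => g /pgs [].
case: g => [|u [|v g]] //= _ /andP[]; rewrite inE negb_or => /andP[uv _] _ _ _ _.
by rewrite (bigD1 (Sub (u, v) uv : arc N)) //= inE /= inE eqxx.
Qed.

Lemma lambdaP (N : network) (y z : N) (X : {set N}) :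
  (exists2 gs, max_arc_disjoint y z gs & num_through X gs = lambda y z X) /\
  (forall gs, max_arc_disjoint y z gs -> lambda y z X <= num_through X gs).
Proof.
pose P n := `[< exists2 gs, arc_disjoint y z gs & size gs = n >].
have exP : exists n, P n by exists 0; apply/asboolP; exists [::].
have bP n : P n -> n <= \sum_(a : arc N) cap a.
  by move=> /asboolP[gs /arc_disjoint_size + <-].
have [n /asboolP[gs gsD gsn] nmax] := ex_maxnP exP bP.
set S := [set num_through X gs | gs in max_arc_disjoint y z].
pose Q n := `[< S n >].
have exQ : exists n, Q n.
  exists (num_through X gs); apply/asboolP; exists gs => //; split=> // gs' D'.
  by rewrite gsn; apply: nmax; apply/asboolP; exists gs'.
have [m /asboolP Qm mmin] := ex_minnP exQ.
have : (S `&` lbound S) (lambda y z X).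
  apply: xgetPex; exists m; split=> // k Sk.
  by rewrite leEnat; apply: mmin; apply/asboolP.
case=> [[hs hM <-] lb]; split; first by exists hs.
by move=> h hh; rewrite -leEnat; apply: lb; exists h.
Qed.

(* Main.v *)
Require Import Defs.
From mathcomp Require Import all_boot all_order all_algebra.
From mathcomp Require Import zify.

(** The witness has unit capacities on seven arcs,
      y -> p -> a -> z,   y -> b -> q -> z   and   b -> a,
    with X = {p, q}.

    The maximum flow of the whole network is 2. Deleting p and q leaves the
    path y, b, a, z, so the maximum flow drops by only 1. The second unit of
    flow, however, comes from the augmenting path y, p, a, b, q, z, which
    cancels the arc b -> a and thereby forces both units through X, although
    each of them through a different vertex of X.

    To see that a maximum sequence of paths cannot avoid this, consider the cut
    {y, p, a}. Its outgoing arcs are y -> b and a -> z, of total capacity 2.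
    Every path uses at least one of them; a path avoiding X must leave y
    through b and enter z from a, hence uses both ([crossings_ge]). So the
    number of paths plus the number of those that avoid X is at most 2
    ([paths_plus_avoiding_le2]). Since there are two arc-disjoint paths, no path
    of a maximum sequence avoids X, and lambda >= 2 while phi <= 1. *)

Set Implicit Arguments.
Unset Strict Implicit.
Unset Printing Implicit Defensive.
Import Order.TTheory GRing.Theory Num.Theory.
Local Open Scope nat_scope.

(** The cut S is a predicate rather than a finite set so that membership in an
    explicit list of vertices is decided by computation. *)
Lemma path_crosses (N : network) (y z : N) (S : {pred N}) (g : seq N) :
  is_path y z g -> y \in S -> z \notin S ->
  exists a : Defs.arc N, [/\ a \in path_arcs g, src a \in S, tgt a \notin S,
                        src a \in g & tgt a \in g].
Proof.
case: g => [|x s] [] // _ us xy lz _; rewrite /= in xy lz; rewrite -{}xy.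
elim: s x us lz => [|v s IHs] u /=.
  by move=> _ <- ->.
move=> /andP[]; rewrite inE negb_or => /andP[uv _] us lz uS zS.
have [vS|vS] := boolP (v \in S); last first.
  by exists (Sub (u, v) uv); split=> //=; rewrite /src /tgt !inE /= ?eqxx ?orbT.
have [a [ag aS atS ags agt]] := IHs v us lz vS zS.
exists a; split=> //.
- by move: ag; rewrite !inE => ->; rewrite orbT.
- by rewrite inE ags orbT.
- by rewrite inE agt orbT.
Qed.

Lemma flow_value_le (N : network) (y z : N) (f : Defs.arc N -> nat) :
  is_flow y z f -> (flow_value y f <= (outflow (@cap N) y)%:Z)%R.
Proof.
case=> fc _; apply: (@le_trans _ _ (outflow f y)%:Z%R).
  by rewrite /flow_value gerBl.
by rewrite lez_nat; apply: leq_sum => a _; apply: fc.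
Qed.

(** Sums over the subtype of arcs do not compute. For a function that counts
    the occurrences in a list of arcs they become a count over that list, which
    does compute; capacities and flows below are therefore given by lists of
    arcs. *)
Lemma sum_count_mem (V : finType) (P : pred (V * V)) (E : seq (V * V)) :
  all (fun e => e.1 != e.2) E ->
  \sum_(a : Defs.arc V | P (val a)) count_mem (val a) E = count P E.
Proof.
move=> loopless.
rewrite -(big_sub_cond _ P (fun e => count_mem e E)).
elim: E loopless => [_|e E IHE /= /andP[eN /IHE {}IHE]]; first by rewrite big1.
rewrite big_split /= IHE; congr (_ + _).
have [Pe|/negPf NPe] := boolP (P e).
  rewrite (bigD1 e) /= ?Pe ?andbT // eqxx big1 // => x /andP[_ /negPf].
  by rewrite eq_sym => ->.
by rewrite big1 // => x /andP[_ Px]; have [ex|] := eqVneq; rewrite // ex Px in NPe.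
Qed.

Local Notation V := 'I_6.
Local Notation y := (@Ordinal 6 0 isT).
Local Notation p := (@Ordinal 6 1 isT).
Local Notation a := (@Ordinal 6 2 isT).
Local Notation b := (@Ordinal 6 3 isT).
Local Notation q := (@Ordinal 6 4 isT).
Local Notation z := (@Ordinal 6 5 isT).

Definition arcs : seq (V * V) :=
  [:: (y, p); (p, a); (a, z); (y, b); (b, q); (q, z); (b, a)].

Lemma two_vertices : 2 <= #|V|. Proof. by rewrite card_ord. Qed.

Definition witness : network :=
  Network two_vertices (fun e => count_mem (val e) arcs).

Definition X : {set witness} := [set p; q].

Lemma vertex_ind (P : V -> Prop) :
  P y -> P p -> P a -> P b -> P q -> P z -> forall v, P v.
Proof.
by move=> Py Pp Pa Pb Pq Pz [[|[|[|[|[|[|i]]]]]] lti] //;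
  rewrite (bool_irrelevance lti isT).
Qed.

(** The arcs out of y bound the flow of the whole network by 2, and the unit of
    flow along y, b, a, z survives the deletion of p and q. *)
Lemma phi_le1 : (@phi witness y z X <= 1)%R.
Proof.
have sumE P : \sum_(e : Defs.arc V | P (val e)) count_mem (val e) arcs
            = count P arcs by apply: sum_count_mem.
have le2 : (@max_flow witness y z <= 2)%R.
  have [[f fF <-] _] := @max_flowP witness y z.
  apply: le_trans (flow_value_le fF) _.
  by rewrite /outflow /src (sumE [pred e | e.1 == y]).
have ge1 : (1 <= @max_flow (@remove witness X) y z)%R.
  pose F : seq (V * V) := [:: (y, b); (b, a); (a, z)].
  have sumF P : \sum_(e : Defs.arc V | P (val e)) count_mem (val e) F
              = count P F by apply: sum_count_mem.
  have outF u : outflow (fun e : Defs.arc V => count_mem (val e) F) u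
              = count [pred e | e.1 == u] F by exact: sumF.
  have inF u : inflow (fun e : Defs.arc V => count_mem (val e) F) u
              = count [pred e | e.2 == u] F by exact: sumF.
  have [_] := @max_flowP (@remove witness X) y z.
  move/(_ (fun e => count_mem (val e) F)).
  rewrite /flow_value outF inF; apply; split=> [[[u v] uv]|u uy uz] /=; last first.
    by rewrite outF inF; elim/vertex_ind: u uy uz.
  rewrite /src /tgt !inE /=.
  by elim/vertex_ind: u uv; elim/vertex_ind: v.
by rewrite /phi; lia.
Qed.

Definition yb : Defs.arc V := Sub (y, b) isT.
Definition az : Defs.arc V := Sub (a, z) isT.

(** The arcs yb and az are those leaving the cut {y, p, a}, so every path
    uses one of them. They are also the only arc out of y and the only arc into
    z that do not touch X, so a path avoiding X uses both. *)
Lemma crossings_ge (g : seq V) : @is_path witness y z g ->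
  1 + ~~ passes_through X g <= (yb \in path_arcs g) + (az \in path_arcs g).
Proof.
move=> pg; have [_ _ _ _ capg] := pg.
have crosses (S : {pred V}) : y \in S -> z \notin S ->
    exists e : Defs.arc V, [/\ e \in path_arcs g,
      val e \in [seq e <- arcs | (e.1 \in S) && (e.2 \notin S)],
      src e \in g & tgt e \in g].
  move=> yS zS; have [e [eg eS eS' sg tg]] := path_crosses pg yS zS.
  exists e; split=> //; rewrite mem_filter eS eS' /=.
  by rewrite -has_pred1 has_count; apply: capg.
have [thru|/hasPn avoid] := boolP (passes_through X g).
  have [e [eg eS _ _]] := crosses (mem [:: y; p; a]) isT isT.
  rewrite /= !inE in eS; case/orP: eS => /eqP eE.
    by rewrite (_ : az = e) ?eg ?addn1 //; apply: val_inj.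
  by rewrite (_ : yb = e) ?eg //; apply: val_inj.
have -> : yb \in path_arcs g.
  have [e [eg eS _ tg]] := crosses (mem [:: y]) isT isT.
  rewrite /= !inE in eS; case/orP: eS => /eqP eE.
    by have := avoid _ tg; rewrite /tgt [val e]eE !inE.
  by rewrite (_ : yb = e) //; apply: val_inj.
have -> // : az \in path_arcs g.
have [e [eg eS sg _]] := crosses [pred v | v != z] isT isT.
rewrite /= !inE in eS; case/orP: eS => /eqP eE.
  by rewrite (_ : az = e) //; apply: val_inj.
by have := avoid _ sg; rewrite /src [val e]eE !inE.
Qed.

(** Summing [crossings_ge] over the paths, each of the arcs yb and az is used
    at most once. *)
Lemma paths_plus_avoiding_le2 (gs : seq (seq V)) :
  @arc_disjoint witness y z gs ->
  size gs + count (predC (passes_through X)) gs <= 2.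
Proof.
case=> pgs capgs.
apply: leq_trans (leq_add (capgs yb) (capgs az)).
elim: gs pgs {capgs} => //= g gs IHgs pgs.
have := crossings_ge (pgs g (mem_head _ _)).
have := IHgs (fun h hgs => pgs h (mem_behead (s := g :: gs) hgs)).
by rewrite /=; lia.
Qed.

Lemma two_disjoint_paths :
  @arc_disjoint witness y z [:: [:: y; p; a; z]; [:: y; b; q; z]].
Proof.
have mem_arcs (e : Defs.arc V) s :
    (e \in path_arcs s) = (val e \in zip s (behead s)) by rewrite inE.
split=> [g|[[u v] uv]]; last first.
  rewrite /= !mem_arcs /=.
  by elim/vertex_ind: u uv; elim/vertex_ind: v.
by rewrite !inE => /orP[]/eqP->; split=> // -[[u v] uv]; rewrite mem_arcs /=;
  elim/vertex_ind: u uv; elim/vertex_ind: v.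
Qed.

Lemma lambda_ge2 : 2 <= @lambda witness y z X.
Proof.
have [[gs [gsD gs_max] <-] _] := @lambdaP witness y z X.
have := paths_plus_avoiding_le2 gsD.
have := gs_max _ two_disjoint_paths.
by have := count_predC (passes_through X) gs; rewrite /num_through /=; lia.
Qed.

Theorem proposition20 :
  exists (N : network) (X : {set N}) (y z : N),
    y != z /\ ((lambda y z X)%:Z > phi y z X)%R.
Proof.
exists witness, X, y, z; split=> //.
by apply: le_lt_trans phi_le1 _; rewrite ltz_nat; apply: lambda_ge2.
Qed.
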